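(* Let $P \colon \mathcal{C}^{\mathrm{op}} \to \mathbf{DL}$ be a coherent doctrine, let $Q \colon \mathcal{D}^{\mathrm{op}} \to \mathbf{DL}^+$ be a $DL^+$-doctrine, and let $(M,\alpha) \colon P \to Q$ be a morphism of coherent doctrines. The following are equivalent: (i) there exists a morphism of $DL^+$-doctrines $P^\delta \to Q$ whose restriction to $P$ is $(M,\alpha)$; (ii) the pair $(M,\alpha^\sharp) \colon P^\delta \to Q$ is a morphism of $DL^+$-doctrines; (iii) for any objects $c_1, c_2$ of $\mathcal{C}$, with $\pi_1 \colon c_1 \times c_2 \to c_1$ the left projection, one has, pointwise on $P^\delta(c_1\times c_2)$, $$\alpha^\sharp_{c_1} \circ (\exists^P_{\pi_1})^\sigma \;\leq\; \exists^Q_{M\pi_1} \circ \alpha^\sharp_{c_1 \times c_2}.$$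
   Context: All lattices are bounded; $\mathbf{DL}$ is the category of distributive lattices and bounded lattice morphisms. An element $x$ of a complete lattice $C$ is completely join-prime if $x \leq \bigvee S$ implies $x \leq s$ for some $s \in S$, for all $S \subseteq C$. A $DL^+$ is a complete lattice in which every element is a join of completely join-prime elements; $\mathbf{DL}^+$ is the category of $DL^+$s with maps preserving arbitrary joins and meets (complete morphisms). A coherent doctrine is a functor $P \colon \mathcal{C}^{\mathrm{op}} \to \mathbf{DL}$, where $\mathcal{C}$ has finite limits, such that for each $f \colon c \to c'$ in $\mathcal{C}$ the map $Pf \colon Pc' \to Pc$ has a left adjoint $\exists^P_f \colon Pc \to Pc'$, satisfying Frobenius reciprocity ($\exists^P_f(\phi \wedge (Pf)(\psi)) = \exists^P_f(\phi) \wedge \psi$) and Beck-Chevalley (for any pullback of $f_1 \colon c_1 \to c$ and $f_2 \colon c_2 \to c$ with projections $\pi_1,\pi_2$, $Pf_1 \circ \exists^P_{f_2} = \exists^P_{\pi_1} \circ P\pi_2$). A morphism of coherent doctrines from $P\colon \mathcal{C}^{\mathrm{op}} \to \mathbf{DL}$ to $Q \colon \mathcal{D}^{\mathrm{op}} \to \mathbf{DL}$ is a pair $(M,\alpha)$ with $M \colon \mathcal{C} \to \mathcal{D}$ a finite-limit-preserving functor and $\alpha \colon P \Rightarrow Q \circ M^{\mathrm{op}}$ a natural transformation such that $\alpha_{c'} \circ \exists^P_f = \exists^Q_{Mf} \circ \alpha_c$ for every $f \colon c \to c'$ in $\mathcal{C}$. A $DL^+$-doctrine is a coherent doctrine taking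 values in $\mathbf{DL}^+$; a morphism of $DL^+$-doctrines is a morphism $(M,\alpha)$ of coherent doctrines each of whose components $\alpha_c$ is a complete morphism. The canonical extension of a distributive lattice $L$ is the (unique up to isomorphism fixing $L$) complete lattice $L^\delta$ containing $L$ as a sublattice such that every element of $L^\delta$ is a join of filter elements (meets of subsets of $L$) and a meet of ideal elements (joins of subsets of $L$), and such that for $S,T \subseteq L$, $\bigwedge S \leq \bigvee T$ in $L^\delta$ implies $\bigwedge S' \leq \bigvee T'$ for some finite $S' \subseteq S$, $T' \subseteq T$. It is a $DL^+$, and every lattice morphism $f \colon L \to C$ with $C$ a $DL^+$ extends uniquely to a complete morphism $f^\sharp \colon L^\delta \to C$; for $f \colon L \to K$ in $\mathbf{DL}$, $f^\delta \colon L^\delta \to K^\delta$ is the unique complete morphism extending $f$. For a coherent doctrine $P$, $P^\delta := (-)^\delta \circ P$, which is a $DL^+$-doctrine on $\mathcal{C}$; the left adjoint of $P^\delta f$ is the map $(\exists^P_f)^\sigma(u) = \bigvee\{\bigwedge\{\exists^P_f a : a \in Pc,\ x \leq a\} : x \text{ a filter element of } P^\delta c,\ x \leq u\}$. Given a morphism $(M,\alpha) \colon P \to Q$ with $Q$ a $DL^+$-doctrine, $\alpha^\sharp \colon P^\delta \Rightarrow Q \circ M^{\mathrm{op}}$ is the natural transformation with components $(\alpha_c)^\sharp$. The restriction to $P$ of a morphism $(N,\beta) \colon P^\delta \to Q$ is the pair $(N,\beta')$ where $\beta'_c$ is the restriction of $\beta_c$ to $Pc \subseteq P^\delta c$. 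*)

(* Defs.v *)
From HB Require Import structures.
From mathcomp Require Import all_boot all_order.
From mathcomp Require Import boolp classical_sets.

Set Implicit Arguments.
Unset Strict Implicit.
Unset Printing Implicit Defensive.

Import Order.TTheory.
Local Open Scope classical_set_scope.
Local Open Scope order_scope.

(** * Categories *)

(* Hom-types are compared with Leibniz equality. *)
Record category := Category {
  ob :> Type;
  hom : ob -> ob -> Type;
  idm : forall a, hom a a;
  cmp : forall a b c, hom b c -> hom a b -> hom a c;
  cmpA : forall a b c d (h : hom c d) (g : hom b c) (f : hom a b),
    cmp h (cmp g f) = cmp (cmp h g) f;
  cmp1m : forall a b (f : hom a b), cmp (idm b) f = f;
  cmpm1 : forall a b (f : hom a b), cmp f (idm a) = f }.

Arguments hom {c} _ _ : rename.
Arguments idm {c} a : rename.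
Arguments cmp {c0 a b c} _ _ : rename.

Definition opcat (C : category) : category :=
  @Category (ob C) (fun a b => @hom C b a) (@idm C)
    (fun a b c g f => cmp f g)
    (fun a b c d h g f => esym (cmpA f g h))
    (fun a b f => cmpm1 f) (fun a b f => cmp1m f).

Record functor (C D : category) := Functor {
  fob :> C -> D;
  fmap : forall a b : C, hom a b -> hom (fob a) (fob b);
  fmap_id : forall a : C, fmap (idm a) = idm (fob a);
  fmap_cmp : forall (a b c : C) (g : hom b c) (f : hom a b),
    fmap (cmp g f) = cmp (fmap g) (fmap f) }.

Arguments fmap {C D} f {a b} _ : rename.

Lemma fcomp_id (C D E : category) (G : functor D E) (F : functor C D) (a : C) :
  fmap G (fmap F (idm a)) = idm (G (F a)).
Proof. by rewrite !fmap_id. Qed.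

Lemma fcomp_cmp (C D E : category) (G : functor D E) (F : functor C D)
    (a b c : C) (g : hom b c) (f : hom a b) :
  fmap G (fmap F (cmp g f)) = cmp (fmap G (fmap F g)) (fmap G (fmap F f)).
Proof. by rewrite !fmap_cmp. Qed.

Definition fcomp (C D E : category) (G : functor D E) (F : functor C D) :
    functor C E :=
  @Functor C E (fun a => G (F a)) (fun a b f => fmap G (fmap F f))
    (fcomp_id G F) (fcomp_cmp G F).

Definition opfun (C D : category) (F : functor C D) :
    functor (opcat C) (opcat D) :=
  @Functor (opcat C) (opcat D) (fob F) (fun a b f => @fmap C D F b a f)
    (fmap_id F) (fun a b c g f => @fmap_cmp C D F c b a f g).

Record nat_trans (C D : category) (F G : functor C D) := NatTrans {
  ntc :> forall a : C, hom (F a) (G a);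
  ntcP : forall (a b : C) (f : hom a b),
    cmp (ntc b) (fmap F f) = cmp (fmap G f) (ntc a) }.

Lemma nat_trans_eq (C D : category) (F G : functor C D) (s t : nat_trans F G) :
  (forall a, s a = t a) -> s = t.
Proof.
case: s t => [s sP] [t tP] /= st.
have {}st : s = t by apply: functional_extensionality_dep.
by subst t; rewrite (Prop_irrelevance sP tP).
Qed.

Lemma nat_cmpP (C D : category) (F G H : functor C D)
    (t : nat_trans G H) (s : nat_trans F G) (a b : C) (f : hom a b) :
  cmp (cmp (t b) (s b)) (fmap F f) = cmp (fmap H f) (cmp (t a) (s a)).
Proof. by rewrite -cmpA ntcP cmpA ntcP cmpA. Qed.

Definition nat_cmp (C D : category) (F G H : functor C D)
    (t : nat_trans G H) (s : nat_trans F G) : nat_trans F H :=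
  @NatTrans C D F H (fun a => cmp (t a) (s a)) (nat_cmpP t s).

(** * Finite limits *)

Record cone (J C : category) (D : functor J C) := Cone {
  apex : C;
  leg : forall j : J, hom apex (D j);
  legP : forall (i j : J) (u : hom i j), cmp (fmap D u) (leg i) = leg j }.

Definition is_limit (J C : category) (D : functor J C) (K : cone D) : Prop :=
  forall K' : cone D, exists! h : hom (apex K') (apex K),
    forall j : J, cmp (leg K j) h = leg K' j.

Lemma map_legP (J C C' : category) (F : functor C C') (D : functor J C)
    (K : cone D) (i j : J) (u : hom i j) :
  cmp (fmap (fcomp F D) u) (fmap F (leg K i)) = fmap F (leg K j).
Proof. by rewrite -fmap_cmp legP. Qed.

Definition map_cone (J C C' : category) (F : functor C C') (D : functor J C)
    (K : cone D) : cone (fcomp F D) :=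
  @Cone J C' (fcomp F D) (F (apex K)) (fun j => fmap F (leg K j))
    (map_legP F K).

(* finite_set would force the objects of J into the universe of the carriers
   of lattices, which the category of all lattices cannot fit in. *)
Definition finite_type (T : Type) : Prop :=
  exists (n : nat) (f : 'I_n -> T), forall x, exists i, f i = x.

Definition finite_category (J : category) : Prop :=
  finite_type J /\ forall a b : J, finite_type (hom a b).

Definition has_finite_limits (C : category) : Prop :=
  forall J : category, finite_category J ->
  forall D : functor J C, exists K : cone D, is_limit K.

Definition preserves_finite_limits (C C' : category) (F : functor C C') : Prop :=
  forall J : category, finite_category J ->
  forall (D : functor J C) (K : cone D), is_limit K -> is_limit (map_cone F K).

Definition is_pullback (C : category) (c1 c2 c p : C)
    (f1 : hom c1 c) (f2 : hom c2 c) (p1 : hom p c1) (p2 : hom p c2) : Prop :=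
  cmp f1 p1 = cmp f2 p2 /\
  forall (x : C) (g1 : hom x c1) (g2 : hom x c2), cmp f1 g1 = cmp f2 g2 ->
    exists! h : hom x p, cmp p1 h = g1 /\ cmp p2 h = g2.

Definition is_product (C : category) (c1 c2 p : C)
    (p1 : hom p c1) (p2 : hom p c2) : Prop :=
  forall (x : C) (g1 : hom x c1) (g2 : hom x c2),
    exists! h : hom x p, cmp p1 h = g1 /\ cmp p2 h = g2.

(** * Bounded distributive lattices *)

(* MathComp's {tblmorphism L -> K} only asks for the preservation of the
   bounds, and {lmorphism L -> K} only for that of the binary operations. *)
Definition bounded_lattice_morphism d (L : tbLatticeType d)
    d' (K : tbLatticeType d') (f : L -> K) : Prop :=
  [/\ Order.meet_morphism f, Order.join_morphism f,
      f \bot = \bot & f \top = \top].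

Record dl_hom d (L : tbLatticeType d) d' (K : tbLatticeType d') := DLHom {
  dl_fun :> L -> K;
  dl_homP : bounded_lattice_morphism dl_fun }.

Lemma dl_hom_eq d (L : tbLatticeType d) d' (K : tbLatticeType d')
  (f g : dl_hom L K) : f =1 g -> f = g.
Proof.
case: f g => [f fP] [g gP] /= /funext fg.
by subst g; rewrite (Prop_irrelevance fP gP).
Qed.

Lemma dl_idP d (L : tbLatticeType d) : bounded_lattice_morphism (@idfun L).
Proof. by split. Qed.

Lemma dl_cmpP d (L : tbLatticeType d) d' (K : tbLatticeType d')
    d'' (N : tbLatticeType d'') (g : dl_hom K N) (f : dl_hom L K) :
  bounded_lattice_morphism (g \o f).
Proof.
case: g f => [g [gI gU g0 g1]] [f [fI fU f0 f1]]; split=> /= [x y|x y||].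
- by rewrite /= fI gI.
- by rewrite /= fU gU.
- by rewrite f0.
- by rewrite f1.
Qed.

Definition dl_id d (L : tbLatticeType d) : dl_hom L L := DLHom (dl_idP L).
Definition dl_cmp d (L : tbLatticeType d) d' (K : tbLatticeType d')
    d'' (N : tbLatticeType d'') (g : dl_hom K N) (f : dl_hom L K) :
  dl_hom L N := DLHom (dl_cmpP g f).

(* The display d is a notational tag without mathematical content. *)
Definition DL (d : Order.disp_t) : category.
Proof.
refine (@Category (tbDistrLatticeType d) (fun L K => dl_hom L K)
  (fun L => dl_id L) (fun L K N g f => dl_cmp g f) _ _ _).
- by abstract (move=> *; exact: dl_hom_eq).
- by abstract (move=> *; exact: dl_hom_eq).
- by abstract (move=> *; exact: dl_hom_eq).
Defined.

(** * Complete lattices and DL+s *)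

Definition complete_lattice d (L : tbLatticeType d) : Prop :=
  forall S : set L, (exists x, supremums S x) /\ (exists x, infimums S x).

(* In a complete lattice these are the join and the meet of S, including
   the case of the empty set. *)
Definition bigjoin d (L : tbLatticeType d) (S : set L) : L :=
  supremum \bot S.
Definition bigmeet d (L : tbLatticeType d) (S : set L) : L :=
  infimum \top S.

Definition completely_join_prime d (L : tbLatticeType d) (x : L) : Prop :=
  forall S : set L, x <= bigjoin S -> exists2 s, S s & x <= s.

(* Distributivity is a consequence, see DLplus_meetUl. *)
Definition is_DLplus d (L : tbLatticeType d) : Prop :=
  complete_lattice L /\
  forall x : L, exists2 S : set L,
    S `<=` @completely_join_prime d L & x = bigjoin S.

Record DLplus (d : Order.disp_t) := MkDLplus {
  dlp_lat : tbLatticeType d;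
  dlp_latP : is_DLplus dlp_lat }.

Section CompleteLattice.
Variables (d : Order.disp_t) (L : tbLatticeType d).
Hypothesis cL : complete_lattice L.

Lemma bigjoinP (S : set L) : supremums S (bigjoin S).
Proof.
rewrite /bigjoin /supremum; case: ifPn => [/eqP ->|_].
  by split=> [x //|x _]; exact: le0x.
by have [[x Sx] _] := cL S; case: xgetP => // /(_ x).
Qed.

Lemma bigmeetP (S : set L) : infimums S (bigmeet S).
Proof.
rewrite /bigmeet /infimum; case: ifPn => [/eqP ->|_].
  by split=> [x //|x _]; exact: lex1.
by have [_ [x Sx]] := cL S; case: xgetP => // /(_ x).
Qed.

Lemma bigjoin_ub (S : set L) x : S x -> x <= bigjoin S.
Proof. by have [ub _] := bigjoinP S; apply: ub. Qed.

Lemma bigjoin_le (S : set L) y : (forall x, S x -> x <= y) -> bigjoin S <= y.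
Proof. by have [_ lub] := bigjoinP S; apply: lub. Qed.

Lemma bigmeet_lb (S : set L) x : S x -> bigmeet S <= x.
Proof. by have [lb _] := bigmeetP S; apply: lb. Qed.

Lemma le_bigmeet (S : set L) y : (forall x, S x -> y <= x) -> y <= bigmeet S.
Proof. by have [_ glb] := bigmeetP S; apply: glb. Qed.

End CompleteLattice.

Section DLplusTheory.
Variables (d : Order.disp_t) (L : tbLatticeType d).
Hypothesis LP : is_DLplus L.
Let cL : complete_lattice L := LP.1.

Lemma cjp_le (x y : L) :
  (forall j, completely_join_prime j -> j <= x -> j <= y) -> x <= y.
Proof.
move=> h; have [S Sj xE] := LP.2 x; rewrite xE; apply: bigjoin_le => // j Sj'.
by apply: h; [exact: Sj|rewrite xE; exact: bigjoin_ub].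
Qed.

Lemma cjp_join (j x y : L) :
  completely_join_prime j -> j <= x `|` y -> j <= x \/ j <= y.
Proof.
move=> jp jxy; have [|s [->|->] js] := jp [set x; y]; [|by left|by right].
by apply: (le_trans jxy); rewrite leUx !bigjoin_ub //=; [right|left].
Qed.

Lemma cjp_bot (j : L) : completely_join_prime j -> ~ j <= \bot.
Proof. by move=> jp j0; have [|s] := jp set0; first exact: le_trans (le0x _). Qed.

Lemma DLplus_meetUl : @left_distributive L L Order.meet Order.join.
Proof.
move=> x y z; apply: le_anti; apply/andP; split.
  apply: cjp_le => j jp; rewrite lexI => /andP[/(cjp_join jp)[jx|jy] jz].
    by apply: le_trans (leUl _ _); rewrite lexI jx.
  by apply: le_trans (leUr _ _); rewrite lexI jy.
by rewrite leUx !leI2 // ?leUl ?leUr.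
Qed.

End DLplusTheory.

Definition dlp_sort d (K : DLplus d) : Type := dlp_lat K.
HB.instance Definition _ d (K : DLplus d) :=
  Order.TBLattice.copy (dlp_sort K) (dlp_lat K).
HB.instance Definition _ d (K : DLplus d) :=
  Order.Lattice_Meet_isDistrLattice.Build d (dlp_sort K)
    (DLplus_meetUl (dlp_latP K)).

Definition dlp_DL d (K : DLplus d) : tbDistrLatticeType d := dlp_sort K.
Coercion dlp_DL : DLplus >-> Order.TBDistrLattice.type.

Lemma dlpP d (K : DLplus d) : is_DLplus K.
Proof. exact: dlp_latP. Qed.

Definition complete_morphism d (K : tbLatticeType d) d' (K' : tbLatticeType d')
    (f : K -> K') : Prop :=
  forall S : set K,
    f (bigjoin S) = bigjoin (f @` S) /\ f (bigmeet S) = bigmeet (f @` S).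

Record dlp_hom d (K K' : DLplus d) := DLPHom {
  dlp_fun :> K -> K';
  dlp_homP : complete_morphism dlp_fun }.

Lemma dlp_hom_eq d (K K' : DLplus d) (f g : dlp_hom K K') : f =1 g -> f = g.
Proof.
case: f g => [f fP] [g gP] /= /funext fg.
by subst g; rewrite (Prop_irrelevance fP gP).
Qed.

Lemma dlp_idP d (K : DLplus d) : complete_morphism (@idfun K).
Proof. by move=> S; rewrite !image_id. Qed.

Lemma dlp_cmpP d (K K' K'' : DLplus d) (g : dlp_hom K' K'')
  (f : dlp_hom K K') : complete_morphism (g \o f).
Proof.
move=> S; rewrite -image_comp /=; have [-> ->] := dlp_homP f S.
by have [-> _] := dlp_homP g (f @` S); have [_ ->] := dlp_homP g (f @` S).
Qed.

Definition DLP (d : Order.disp_t) : category.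
Proof.
refine (@Category (DLplus d) (fun K K' => dlp_hom K K')
  (fun K => DLPHom (@dlp_idP d K)) (fun K K' K'' g f => DLPHom (dlp_cmpP g f))
  _ _ _).
- by abstract (move=> *; exact: dlp_hom_eq).
- by abstract (move=> *; exact: dlp_hom_eq).
- by abstract (move=> *; exact: dlp_hom_eq).
Defined.

Section CompleteBounded.
Variables (d : Order.disp_t) (K : tbLatticeType d).
Hypothesis cK : complete_lattice K.

Lemma bigjoin2 (x y : K) : bigjoin [set x; y] = x `|` y.
Proof.
apply: le_anti; apply/andP; split.
  by apply: bigjoin_le => // z [->|->]; rewrite ?leUl ?leUr.
by rewrite leUx !bigjoin_ub //=; [right|left].
Qed.

Lemma bigmeet2 (x y : K) : bigmeet [set x; y] = x `&` y.
Proof.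
apply: le_anti; apply/andP; split.
  by rewrite lexI !bigmeet_lb //=; [right|left].
by apply: le_bigmeet => // z [->|->]; rewrite ?leIl ?leIr.
Qed.

Lemma bigjoin0 : bigjoin (@set0 K) = \bot.
Proof. by apply: le_anti; rewrite le0x bigjoin_le. Qed.

Lemma bigmeet0 : bigmeet (@set0 K) = \top.
Proof. by apply: le_anti; rewrite lex1 le_bigmeet. Qed.
End CompleteBounded.

Lemma complete_bounded d (K : tbLatticeType d) d' (K' : tbLatticeType d')
    (f : K -> K') : complete_lattice K -> complete_lattice K' ->
  complete_morphism f -> bounded_lattice_morphism f.
Proof.
move=> cK cK' fP; split=> [x y|x y||].
- by rewrite -!bigmeet2 // (fP _).2 image_setU !image_set1.
- by rewrite -!bigjoin2 // (fP _).1 image_setU !image_set1.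
- by rewrite -(bigjoin0 cK) (fP _).1 image_set0 bigjoin0.
- by rewrite -(bigmeet0 cK) (fP _).2 image_set0 bigmeet0.
Qed.

Definition forget_hom d (K K' : DLplus d) (f : dlp_hom K K') : dl_hom K K' :=
  DLHom (complete_bounded (dlpP K).1 (dlpP K').1 (dlp_homP f)).

Definition forget (d : Order.disp_t) : functor (DLP d) (DL d).
Proof.
refine (@Functor (DLP d) (DL d) (@dlp_DL d) (fun K K' f => forget_hom f) _ _).
- by abstract (move=> *; exact: dl_hom_eq).
- by abstract (move=> *; exact: dl_hom_eq).
Defined.

(** * Canonical extensions *)

Section CanonicalExtension.
Variables (d : Order.disp_t) (L : tbLatticeType d).
Variables (d' : Order.disp_t) (K : tbLatticeType d') (e : L -> K).

Definition filter_element (x : K) : Prop :=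
  exists S : set L, x = bigmeet (e @` S).

Definition ideal_element (x : K) : Prop :=
  exists T : set L, x = bigjoin (e @` T).

Definition dense_embedding : Prop :=
  forall x : K,
    (exists2 X : set K, X `<=` filter_element & x = bigjoin X) /\
    (exists2 Y : set K, Y `<=` ideal_element & x = bigmeet Y).

(* The finite meet and join may be computed in L, which e embeds as a
   bounded sublattice. *)
Definition compact_embedding : Prop :=
  forall S T : set L, bigmeet (e @` S) <= bigjoin (e @` T) ->
    exists s t : seq L, [/\ {in s, forall a, S a}, {in t, forall b, T b}
      & \meet_(a <- s) a <= \join_(b <- t) b].
End CanonicalExtension.

(* Distributivity of ce_lat is a consequence, see ce_is_DLplus. *)
Record canonical_extension d (L : tbDistrLatticeType d) := CanonicalExtension {
  ce_lat : tbLatticeType d;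
  ce_emb : dl_hom L ce_lat;
  ce_complete : complete_lattice ce_lat;
  ce_inj : injective ce_emb;
  ce_dense : dense_embedding ce_emb;
  ce_compact : compact_embedding ce_emb }.

Arguments ce_complete {d L} _.
Arguments ce_inj {d L} _.
Arguments ce_dense {d L} _.
Arguments ce_compact {d L} _.

Definition prime_filter d (L : tbLatticeType d) (p : set L) : Prop :=
  [/\ p \top, ~ p \bot, forall a b, a <= b -> p a -> p b,
      forall a b, p a -> p b -> p (a `&` b)
    & forall a b, p (a `|` b) -> p a \/ p b].

Section PrimeFilterTheorem.
Variables (d : Order.disp_t) (L : tbDistrLatticeType d).
Implicit Types (S T X : set L) (s t : seq L).

Definition linked S T : Prop := exists s t,
  [/\ {in s, forall a, S a}, {in t, forall b, T b}
    & \meet_(a <- s) a <= \join_(b <- t) b].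

Lemma prime_filter_ex S T : ~ linked S T ->
  exists p, [/\ prime_filter p, S `<=` p & forall a, T a -> ~ p a].
Proof.
move=> nST; pose P X := ~ linked (X `|` S) T.
have [F FP Ftot|p [Pp pmax]] := @Zorn_bigcup L P.
  move=> [s [t [sS tT st]]].
  have [[X [FX Xs]]|nX] := pselect (exists X, F X /\ {in s, forall a, (X `|` S) a}).
    by apply: (FP X FX); exists s, t.
  suff : (exists X, F X /\ {in s, forall a, (X `|` S) a})
    \/ {in s, forall a, S a}.
    move=> [[X [FX Xs]]|sS'].
  - by apply: nX; exists X.
  - by apply: nST; exists s, t.
  elim: s sS {st nX} => [|a s IHs] sS; first by right.
  have {}/IHs IHs : {in s, forall a, ((\bigcup_(X in F) X) `|` S) a}.
    by move=> b bs; apply: sS; rewrite in_cons bs orbT.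
  have := sS a (mem_head _ _) => -[[X FX Xa]|Sa].
    left; case: IHs => [[Y [FY Ys]]|sS'].
      have [XY|YX] := Ftot X Y FX FY.
        exists Y; split=> // b; rewrite in_cons => /orP[/eqP->|/Ys//].
        by left; apply: XY.
      exists X; split=> // b; rewrite in_cons => /orP[/eqP->|/Ys[/YX|]].
      - by left.
      - by left.
      - by right.
    exists X; split=> // b; rewrite in_cons => /orP[/eqP->|/sS'].
      by left.
    by right.
  case: IHs => [[Y [FY Ys]]|sS'].
    left; exists Y; split=> // b; rewrite in_cons => /orP[/eqP->|/Ys//].
    by right.
  by right=> b; rewrite in_cons => /orP[/eqP->|/sS'].
have out z : ~ p z -> exists s t, [/\ {in s, forall a, (p `|` S) a},
    {in t, forall b, T b} & z `&` \meet_(a <- s) a <= \join_(b <- t) b].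
  move=> npz; have /pmax : p `<` p `|` [set z].
    split; first by left.
    by move=> /(_ z) h; apply: npz; apply: h; right.
  move=> /contrapT[s [t [sS tT st]]].
  exists [seq a <- s | a != z], t; split=> // [a|].
    by rewrite mem_filter => /andP[/eqP az /sS[[pa|/= /az]|Sa]] //; [left|right].
  apply: le_trans st; elim: s {sS} => [|a s IHs] /=; first by rewrite big_nil lex1.
  rewrite big_cons lexI; case: eqVneq => [->|_] /=.
    by rewrite leIl.
  rewrite big_cons; apply/andP; split; first by rewrite meetCA leIl.
  by apply: le_trans IHs; rewrite meetCA leIr.
have nin s t z : {in s, forall a, (p `|` S) a} -> {in t, forall b, T b} ->
    (p `|` S) z -> ~ z `&` \meet_(a <- s) a <= \join_(b <- t) b.
  move=> sS tT pz zst; apply: Pp; exists (z :: s), t; split=> //.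
    by move=> a; rewrite in_cons => /orP[/eqP->|/sS].
  by rewrite big_cons.
exists p; split; first split.
- apply: contrapT => /out[s [t [sS tT]]]; rewrite meet1x => st.
  by apply: Pp; exists s, t.
- move=> p0; apply: (nin [::] [::] \bot) => //; first by left.
  by rewrite meet0x le0x.
- move=> a b ab pa; apply: contrapT => /out[s [t [sS tT st]]].
  apply: (nin s t a) => //; first by left.
  by apply: le_trans st; rewrite leI2.
- move=> a b pa pb; apply: contrapT => /out[s [t [sS tT st]]].
  apply: (nin (b :: s) t a) => //; last by rewrite big_cons meetA.
    by move=> c; rewrite in_cons => /orP[/eqP->|/sS//]; left.
  by left.
- move=> a b pab; apply: contrapT => /not_orP[/out[s [t [sS tT st]]]].
  move=> /out[s' [t' [sS' tT' st']]].
  apply: (nin (s ++ s') (t ++ t') (a `|` b)) => //; last 1 first.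
  + rewrite !big_cat /= meetUl leUx; apply/andP; split.
      by apply: le_trans (leUl _ _); apply: le_trans st; rewrite leI2 ?leIl.
    by apply: le_trans (leUr _ _); apply: le_trans st'; rewrite leI2 ?leIr.
  + by move=> c; rewrite mem_cat => /orP[/sS|/sS'].
  + by move=> c; rewrite mem_cat => /orP[/tT|/tT'].
  + by left.
- move=> a Sa; apply: contrapT => /out[s [t [sS tT st]]].
  by apply: (nin s t a) => //; right.
- move=> a Ta pa; apply: (nin [::] [:: a] a) => //.
  + by move=> b; rewrite inE => /eqP->.
  + by left.
  + by rewrite big_seq1 leIxl.
Qed.
End PrimeFilterTheorem.

Section CanonicalExtensionTheory.
Variables (d : Order.disp_t) (L : tbDistrLatticeType d).
Variable E : canonical_extension L.
Let K := ce_lat E.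
Let e : dl_hom L K := ce_emb E.
Let cK : complete_lattice K := ce_complete E.
Implicit Types (p S T : set L) (u v x y : K).

Lemma ce_le (a b : L) : (e a <= e b) = (a <= b).
Proof.
have [eI _ _ _] := dl_homP e.
by rewrite !leEmeet -eI (inj_eq (ce_inj E)).
Qed.

Lemma ce_linked S T : bigmeet (e @` S) <= bigjoin (e @` T) -> linked S T.
Proof. exact: (ce_compact E). Qed.

Lemma filter_meet p : p \top -> (forall a b, p a -> p b -> p (a `&` b)) ->
  forall s : seq L, {in s, forall a, p a} -> p (\meet_(a <- s) a).
Proof.
move=> p1 pI; elim=> [|a s IHs] ps; first by rewrite big_nil.
rewrite big_cons; apply: pI; first by apply: ps; rewrite mem_head.
by apply: IHs => b bs; apply: ps; rewrite in_cons bs orbT.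
Qed.

Lemma prime_join p : prime_filter p -> forall t : seq L,
  p (\join_(a <- t) a) -> exists2 a, a \in t & p a.
Proof.
move=> [_ p0 _ _ pU]; elim=> [|a t IHt]; first by rewrite big_nil.
rewrite big_cons => /pU[pa|/IHt[b bt pb]].
  by exists a; rewrite ?mem_head.
by exists b; rewrite // in_cons bt orbT.
Qed.

Definition prime_pt p : K := bigmeet (e @` p).
Definition prime_copt p : K := bigjoin (e @` ~` p).

Lemma prime_pt_emb p a : prime_filter p -> prime_pt p <= e a <-> p a.
Proof.
move=> pp; split=> [pa|pa]; last by apply: bigmeet_lb => //; exists a.
have [|s [t [sp tT st]]] := @ce_linked p [set a].
  by apply: (le_trans pa); apply: bigjoin_ub => //; exists a.
have [p1 p0 pS pI pU] := pp.
have [b /tT->//] := prime_join pp (pS _ _ st (filter_meet p1 pI sp)).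
Qed.

Lemma prime_pt_copt p : prime_filter p -> ~ prime_pt p <= prime_copt p.
Proof.
move=> pp /ce_linked[s [t [sp tT st]]].
have [p1 p0 pS pI pU] := pp.
by have [b /tT] := prime_join pp (pS _ _ st (filter_meet p1 pI sp)).
Qed.

Lemma filter_split p S : prime_filter p ->
  prime_pt p <= bigmeet (e @` S) \/ bigmeet (e @` S) <= prime_copt p.
Proof.
move=> pp; have [Sp|nSp] := pselect (S `<=` p).
  left; apply: le_bigmeet => // _ [a Sa <-]; apply: bigmeet_lb => //.
  by exists a => //; exact: Sp.
right; have [a [Sa npa]] : exists a, S a /\ ~ p a.
  apply: contrapT => h; apply: nSp => a Sa.
  by apply: contrapT => npa; apply: h; exists a.
by apply: (@le_trans _ _ (e a)); [apply: bigmeet_lb|apply: bigjoin_ub] => //;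
  exists a.
Qed.

Lemma prime_split p u : prime_filter p ->
  prime_pt p <= u \/ u <= prime_copt p.
Proof.
move=> pp; have [[X Xf uE] _] := ce_dense E u.
have [[x [Xx px]]|nX] := pselect (exists x, X x /\ prime_pt p <= x).
  by left; apply: (le_trans px); rewrite uE; exact: bigjoin_ub.
right; rewrite uE; apply: bigjoin_le => // x Xx.
have [S xE] := Xf _ Xx; have [px|] := filter_split S pp; last by rewrite xE.
by exfalso; apply: nX; exists x; rewrite xE in Xx *.
Qed.

Lemma prime_pt_cjp p : prime_filter p -> completely_join_prime (prime_pt p).
Proof.
move=> pp S pS; apply: contrapT => nS; apply: (prime_pt_copt pp).
apply: (le_trans pS); apply: bigjoin_le => // s Ss.
by have [ps|//] := prime_split s pp; exfalso; apply: nS; exists s.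
Qed.

Lemma prime_pt_le u v :
  (forall p, prime_filter p -> prime_pt p <= u -> prime_pt p <= v) -> u <= v.
Proof.
move=> uv; have [[X Xf uE] _] := ce_dense E u.
have [_ [Y Yi vE]] := ce_dense E v.
rewrite {1}uE; apply: bigjoin_le => // x Xx.
rewrite vE; apply: le_bigmeet => // y Yy.
have [[S xE] [T yE]] := (Xf _ Xx, Yi _ Yy).
have [ST|/prime_filter_ex[p [pp Sp Tp]]] := pselect (linked S T).
  have [s [t [sS tT st]]] := ST.
  have [eI eU e0 e1] := dl_homP e.
  apply: (@le_trans _ _ (e (\meet_(a <- s) a))).
    rewrite xE; elim: s sS {st} => [|a s IHs] sS.
      by rewrite big_nil e1 lex1.
    rewrite big_cons eI lexI bigmeet_lb //=; last first.
      by exists a => //; apply: sS; rewrite mem_head.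
    by apply: IHs => b bs; apply: sS; rewrite in_cons bs orbT.
  apply: (@le_trans _ _ (e (\join_(a <- t) a))); first by rewrite ce_le.
  rewrite yE; elim: t tT {st} => [|a t IHt] tT.
    by rewrite big_nil e0 le0x.
  rewrite big_cons eU leUx bigjoin_ub //=; last first.
    by exists a => //; apply: tT; rewrite mem_head.
  by apply: IHt => b bt; apply: tT; rewrite in_cons bt orbT.
exfalso; apply: (prime_pt_copt pp).
have pu : prime_pt p <= u.
  apply: (@le_trans _ _ x); last by rewrite uE; exact: bigjoin_ub.
  rewrite xE; apply: le_bigmeet => // _ [a Sa <-]; apply: bigmeet_lb => //.
  by exists a => //; exact: Sp.
apply: (le_trans (uv p pp pu)); apply: (@le_trans _ _ y).
  by rewrite vE; exact: bigmeet_lb.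
rewrite yE; apply: bigjoin_le => // _ [a Ta <-]; apply: bigjoin_ub => //.
by exists a => //; exact: Tp.
Qed.

Lemma ce_is_DLplus : is_DLplus K.
Proof.
split=> // u.
exists [set x | exists p, [/\ prime_filter p, x = prime_pt p & x <= u]].
  by move=> _ [p [pp -> _]]; exact: prime_pt_cjp.
apply: le_anti; apply/andP; split; last by apply: bigjoin_le => // x [p []].
apply: prime_pt_le => p pp pu; apply: bigjoin_ub => //.
by exists p.
Qed.

Definition ce_DLplus : DLplus d := MkDLplus ce_is_DLplus.

Lemma ce_unitP : bounded_lattice_morphism (e : L -> ce_DLplus).
Proof. exact: (dl_homP e). Qed.

Definition ce_unit : dl_hom L ce_DLplus := DLHom ce_unitP.

Section Extension.
Variables (C : DLplus d) (f : dl_hom L C).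

Lemma preim_prime (j : C) : completely_join_prime j ->
  prime_filter [set a | j <= f a].
Proof.
have [fI fU f0 f1] := dl_homP f.
move=> jp; split=> /= [||a b ab|a b ja jb|a b].
- by rewrite f1 lex1.
- by rewrite f0; exact: cjp_bot.
- move=> /le_trans; apply.
  by rewrite -(meet_idPl ab) fI leIr.
- by rewrite fI lexI ja.
- by rewrite fU; apply: cjp_join => //; exact: dlpP.
Qed.

Let ext (u : K) : C := bigjoin [set j | completely_join_prime j /\
  prime_pt [set a | j <= f a] <= u].

Let extP (j : C) (u : K) : completely_join_prime j ->
  j <= ext u <-> prime_pt [set a | j <= f a] <= u.
Proof.
have cC := (dlpP C).1.
move=> jp; split=> [/jp[i [ip iu] ji]|ju]; last first.
  by apply: bigjoin_ub => //; split.
apply: le_trans iu; apply: le_bigmeet => // _ [a /= ia <-].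
by apply: bigmeet_lb => //; exists a => //=; exact: le_trans ia.
Qed.

Let ext_complete : complete_morphism (ext : ce_DLplus -> C).
Proof.
have cC := (dlpP C).1.
move=> S; split; apply: le_anti; apply/andP; split.
- apply: (cjp_le (dlpP C)) => j jp /extP -/(_ jp).
  move=> /(prime_pt_cjp (preim_prime jp))[s Ss js].
  apply: (@le_trans _ _ (ext s)); first exact/extP.
  by apply: bigjoin_ub => //; exists s.
- apply: (cjp_le (dlpP C)) => j jp /jp[_ [s Ss <-]] /extP -/(_ jp) js.
  by apply/extP => //; apply: (le_trans js); exact: bigjoin_ub.
- apply: le_bigmeet => // _ [s Ss <-].
  apply: (cjp_le (dlpP C)) => j jp /extP -/(_ jp) js.
  by apply/extP => //; apply: (le_trans js); exact: bigmeet_lb.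
- apply: (cjp_le (dlpP C)) => j jp js; apply/extP => //.
  apply: le_bigmeet => // s Ss; apply/extP => //.
  by apply: (le_trans js); apply: bigmeet_lb => //; exists s.
Qed.

Lemma sharp_ex : exists g : dlp_hom ce_DLplus C, forall a, g (ce_unit a) = f a.
Proof.
exists (DLPHom ext_complete) => a /=; apply: le_anti; apply/andP; split.
  apply: (cjp_le (dlpP C)) => j jp /extP -/(_ jp).
  by move=> /(prime_pt_emb _ (preim_prime jp)).
apply: (cjp_le (dlpP C)) => j jp ja; apply/extP => //.
exact/(prime_pt_emb _ (preim_prime jp)).
Qed.

Lemma sharp_unique (g h : dlp_hom ce_DLplus C) :
  (forall a, g (ce_unit a) = h (ce_unit a)) -> g = h.
Proof.
move=> gh; apply: dlp_hom_eq => u.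
have [[X Xf uE] _] := ce_dense E u.
rewrite [u in LHS]uE [u in RHS]uE.
rewrite (dlp_homP g X).1 (dlp_homP h X).1; congr bigjoin.
apply: eq_imagel => x /Xf[S ->].
rewrite (dlp_homP g _).2 (dlp_homP h _).2 !image_comp; congr bigmeet.
by apply: eq_imagel => a _; exact: gh.
Qed.

(* The unique complete morphism extending f. *)
Definition sharp : dlp_hom ce_DLplus C := sval (cid sharp_ex).

Lemma sharpE a : sharp (ce_unit a) = f a.
Proof. exact: (svalP (cid sharp_ex)). Qed.

End Extension.
End CanonicalExtensionTheory.

Definition delta_map d (L L' : tbDistrLatticeType d)
    (E : canonical_extension L) (E' : canonical_extension L')
    (f : dl_hom L L') : dlp_hom (ce_DLplus E) (ce_DLplus E') :=
  sharp E (dl_cmp (ce_unit E') f).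

Lemma delta_mapE d (L L' : tbDistrLatticeType d)
    (E : canonical_extension L) (E' : canonical_extension L')
    (f : dl_hom L L') a : delta_map E E' f (ce_unit E a) = ce_unit E' (f a).
Proof. exact: sharpE. Qed.

Definition sigma_ext d (L L' : tbDistrLatticeType d)
    (E : canonical_extension L) (E' : canonical_extension L')
    (g : L -> L') (u : ce_DLplus E) : ce_DLplus E' :=
  bigjoin [set bigmeet [set ce_unit E' (g a) | a in [set a | x <= ce_unit E a]]
          | x in [set x | filter_element (ce_unit E) x /\ x <= u]].

Arguments sigma_ext {d L L'} E E' g u.

Section FilterElements.
Variables (d : Order.disp_t) (L : tbDistrLatticeType d).
Variable E : canonical_extension L.
Let K := ce_DLplus E.
Let e : dl_hom L K := ce_unit E.
Let cK : complete_lattice K := (dlpP K).1.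
Implicit Types (S T : set L) (s t : seq L) (u v x y : K).

Lemma ce_unit_le (a b : L) : (e a <= e b) = (a <= b).
Proof. exact: (ce_le E). Qed.

Lemma ce_unit_meet S s : {in s, forall a, S a} ->
  bigmeet (e @` S) <= e (\meet_(a <- s) a).
Proof.
have [eI _ _ e1] := dl_homP e.
elim: s => [|a s IHs] sS; first by rewrite big_nil e1 lex1.
rewrite big_cons eI lexI bigmeet_lb //=; last first.
  by exists a => //; apply: sS; rewrite mem_head.
by apply: IHs => b bs; apply: sS; rewrite in_cons bs orbT.
Qed.

Lemma ce_unit_join T t : {in t, forall a, T a} ->
  e (\join_(a <- t) a) <= bigjoin (e @` T).
Proof.
have [_ eU e0 _] := dl_homP e.
elim: t => [|a t IHt] tT; first by rewrite big_nil e0 le0x.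
rewrite big_cons eU leUx bigjoin_ub //=; last first.
  by exists a => //; apply: tT; rewrite mem_head.
by apply: IHt => b bt; apply: tT; rewrite in_cons bt orbT.
Qed.

Lemma ce_unit_compact S T : bigmeet (e @` S) <= bigjoin (e @` T) -> linked S T.
Proof. exact: (@ce_linked _ _ E). Qed.

Lemma ce_dense_unit : dense_embedding e.
Proof. exact: (ce_dense E). Qed.

Lemma filter_compact x T : filter_element e x -> x <= bigjoin (e @` T) ->
  exists a t, [/\ x <= e a, {in t, forall b, T b} & a <= \join_(b <- t) b].
Proof.
move=> [S ->] /ce_unit_compact[s [t [sS tT st]]].
by exists (\meet_(a <- s) a), t; split=> //; exact: ce_unit_meet.
Qed.

Lemma bigmeet_setU (A B : set K) :
  bigmeet (A `|` B) = bigmeet A `&` bigmeet B.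
Proof.
apply: le_anti; apply/andP; split.
  rewrite lexI; apply/andP; split; apply: le_bigmeet => // x Ax.
    by apply: bigmeet_lb => //; left.
  by apply: bigmeet_lb => //; right.
apply: le_bigmeet => // x [Ax|Bx].
  by apply: leIxl; exact: bigmeet_lb.
by apply: leIxr; exact: bigmeet_lb.
Qed.

Lemma filter_meet_closed x y : filter_element e x -> filter_element e y ->
  filter_element e (x `&` y).
Proof.
by move=> [S ->] [T ->]; exists (S `|` T); rewrite image_setU bigmeet_setU.
Qed.

Lemma filter_compact2 x y c : filter_element e x -> filter_element e y ->
  x `&` y <= e c -> exists a b, [/\ x <= e a, y <= e b & a `&` b <= c].
Proof.
move=> [S ->] [T ->]; rewrite -bigmeet_setU -image_setU => xyc.
have [|s [t [sST tc st]]] := @ce_unit_compact (S `|` T) [set c].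
  by apply: (le_trans xyc); apply: bigjoin_ub => //; exists c.
have {tc st} sc : \meet_(a <- s) a <= c.
  apply: (le_trans st); elim: t tc {st} => [|b t IHt] tc.
    by rewrite big_nil le0x.
  rewrite big_cons leUx (tc b) ?mem_head //= lexx /=.
  by apply: IHt => b' b't; apply: tc; rewrite in_cons b't orbT.
have [a [b [Sa Tb ab]]] : exists a b, [/\ bigmeet (e @` S) <= e a,
    bigmeet (e @` T) <= e b & a `&` b <= \meet_(a <- s) a].
  have [eI _ _ e1] := dl_homP e.
  elim: s sST {sc} => [|z s IHs] sST.
    by exists \top, \top; rewrite big_nil e1 !lex1.
  have [|a [b [Sa Tb ab]]] := IHs.
    by move=> w ws; apply: sST; rewrite in_cons ws orbT.
  have [Sz|Tz] := sST z (mem_head _ _).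
    exists (z `&` a), b; split=> //; last by rewrite big_cons -meetA leI2.
    by rewrite eI lexI Sa andbT; apply: bigmeet_lb => //; exists z.
  exists a, (z `&` b); split=> //; last by rewrite big_cons meetCA leI2.
  by rewrite eI lexI Tb andbT; apply: bigmeet_lb => //; exists z.
by exists a, b; split=> //; exact: le_trans sc.
Qed.

Lemma join_filter u :
  u = bigjoin [set x | filter_element e x /\ x <= u].
Proof.
apply: le_anti; apply/andP; split; last by apply: bigjoin_le => // x [].
have [[X Xf uE] _] := ce_dense_unit u.
rewrite {1}uE; apply: bigjoin_le => // x Xx; apply: bigjoin_ub => //.
by split; [exact: Xf|rewrite uE; exact: bigjoin_ub].
Qed.

Lemma le_filter u v :
  (forall x, filter_element e x -> x <= u -> x <= v) -> u <= v.
Proof.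
move=> uv; rewrite (join_filter u); apply: bigjoin_le => // x [xf xu].
exact: uv.
Qed.
End FilterElements.

Lemma complete_mono d (K K' : DLplus d) (f : dlp_hom K K') u v :
  u <= v -> f u <= f v.
Proof.
have [fI _ _ _] := dl_homP (forget_hom f).
by move=> uv; rewrite -(meet_idPl uv) (fI : forall x y, f _ = _) leIr.
Qed.

Section LeftAdjoint.
Variables (d : Order.disp_t) (L L' : tbDistrLatticeType d).
Variables (E : canonical_extension L) (E' : canonical_extension L').
Variables (f : dl_hom L L') (g : L' -> L).
Hypothesis gf : forall a b, (g a <= b) = (a <= f b).
Let K := ce_DLplus E.
Let K' := ce_DLplus E'.
Let e : dl_hom L K := ce_unit E.
Let e' : dl_hom L' K' := ce_unit E'.
Let cK : complete_lattice K := (dlpP K).1.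
Let cK' : complete_lattice K' := (dlpP K').1.
Let df : dlp_hom K K' := delta_map E E' f.

Lemma adj_mono (a b : L') : a <= b -> g a <= g b.
Proof. by move=> ab; rewrite gf; apply: (le_trans ab); rewrite -gf. Qed.

Definition filter_ex (x : K') : K :=
  bigmeet [set e (g a) | a in [set a | x <= e' a]].

Lemma filter_map_compact (x : K') (T : set L) :
  filter_ex x <= bigjoin (e @` T) ->
  exists a t, [/\ x <= e' a, {in t, forall b, T b} & g a <= \join_(b <- t) b].
Proof.
rewrite /filter_ex -(image_comp g e) => /ce_unit_compact[s [t [sS tT st]]].
suff [a xa gas] : exists2 a, x <= e' a & g a <= \meet_(a <- s) a.
  by exists a, t; split=> //; exact: le_trans st.
have [eI _ _ e1] := dl_homP e'.
elim: s sS {st} => [|b s IHs] sS.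
  by exists \top; rewrite ?e1 ?big_nil ?lex1.
have [|a xa gas] := IHs.
  by move=> w ws; apply: sS; rewrite in_cons ws orbT.
have [c /= xc cb] := sS b (mem_head _ _).
exists (c `&` a); first by rewrite eI lexI xc.
rewrite big_cons lexI -cb adj_mono ?leIl //=.
by apply: le_trans gas; rewrite adj_mono ?leIr.
Qed.

Lemma filter_map_adj (x : K') (v : K) : filter_element e' x ->
  (filter_ex x <= v) = (x <= df v).
Proof.
move=> xf; have [_ [Y Yi vE]] := ce_dense_unit v.
have ideal y : ideal_element e y -> (filter_ex x <= y) = (x <= df y).
  have [fI fU f0 f1] := dl_homP f.
  move=> [T ->]; apply/idP/idP => [/filter_map_compact[a [t [xa tT at_]]]|].
    apply: (le_trans xa); apply: (@le_trans _ _ (df (e (\join_(b <- t) b)))).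
      by rewrite /df delta_mapE ce_unit_le -gf.
    by apply: complete_mono; exact: ce_unit_join.
  rewrite (dlp_homP df _).1 image_comp.
  rewrite (@eq_imagel _ _ _ _ (e' \o f)); last by move=> a _; exact: delta_mapE.
  rewrite -image_comp => /(filter_compact xf)[a [t [xa tT at_]]].
  suff [c Tc ac] : exists2 c, e c <= bigjoin (e @` T) & a <= f c.
    apply: le_trans Tc; apply: (@le_trans _ _ (e (g a))).
      by apply: bigmeet_lb => //; exists a.
    by rewrite ce_unit_le gf.
  suff [c Tc tc] : exists2 c, e c <= bigjoin (e @` T) & \join_(b <- t) b <= f c.
    by exists c => //; exact: le_trans tc.
  have [_ eU e0 _] := dl_homP e.
  elim: t tT {at_} => [|b t IHt] tT.
    by exists \bot; rewrite ?big_nil ?e0 ?le0x.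
  have [|c Tc tc] := IHt.
    by move=> w wt; apply: tT; rewrite in_cons wt orbT.
  have [z Tz <-] := tT b (mem_head _ _).
  exists (z `|` c); last by rewrite big_cons fU leU2.
  by rewrite eU leUx Tc andbT; apply: bigjoin_ub => //; exists z.
apply/idP/idP => [xv|xv].
  rewrite vE (dlp_homP df _).2; apply: le_bigmeet => // _ [y Yy <-].
  rewrite -ideal; last exact: Yi.
  by apply: (le_trans xv); rewrite vE; exact: bigmeet_lb.
rewrite vE; apply: le_bigmeet => // y Yy; rewrite ideal; last exact: Yi.
by apply: (le_trans xv); apply: complete_mono; rewrite vE; exact: bigmeet_lb.
Qed.

Lemma sigma_ext_adj (u : K') (v : K) :
  (sigma_ext E' E g u <= v) = (u <= df v).
Proof.
apply/idP/idP => [uv|uv].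
  apply: le_filter => x xf xu; rewrite -filter_map_adj //.
  by apply: le_trans uv; apply: bigjoin_ub => //; exists x.
apply: bigjoin_le => // _ [x [xf xu] <-].
by rewrite -/(filter_ex x) filter_map_adj //; exact: le_trans uv.
Qed.

Lemma filter_map_le (x u : K') : filter_element e' x -> x <= u ->
  filter_ex x <= sigma_ext E' E g u.
Proof. by move=> xf xu; apply: bigjoin_ub => //; exists x. Qed.

Lemma delta_filter (x : K) : filter_element e x -> filter_element e' (df x).
Proof.
move=> [S ->]; exists (f @` S).
rewrite (dlp_homP df _).2 !image_comp; congr bigmeet.
by apply: eq_imagel => a _; exact: delta_mapE.
Qed.

(* df x is the meet of the f a with x <= a, and this family is directed. *)
Lemma delta_filter_compact (x : K) (b : L') : filter_element e x ->
  df x <= e' b -> exists2 a, x <= e a & f a <= b.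
Proof.
have [fI fU f0 f1] := dl_homP f; have [eI _ _ e1] := dl_homP e.
move=> [S xE]; rewrite xE (dlp_homP df _).2 image_comp.
rewrite (@eq_imagel _ _ _ _ (e' \o f)); last by move=> a _; exact: delta_mapE.
rewrite -image_comp => xb.
have [|s [t [sS tb st]]] := @ce_unit_compact _ _ E' (f @` S) [set b].
  by apply: (le_trans xb); apply: bigjoin_ub => //; exists b.
have {tb st} sb : \meet_(a <- s) a <= b.
  apply: (le_trans st); elim: t tb {st} => [|c t IHt] tb.
    by rewrite big_nil le0x.
  rewrite big_cons leUx (tb c) ?mem_head //= lexx /=.
  by apply: IHt => b' b't; apply: tb; rewrite in_cons b't orbT.
suff [a xa fa] : exists2 a, bigmeet (e @` S) <= e a & f a <= \meet_(a <- s) a.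
  by exists a => //; exact: le_trans sb.
elim: s sS {sb} => [|c s IHs] sS.
  by exists \top; rewrite ?e1 ?big_nil ?lex1.
have [|a xa fa] := IHs.
  by move=> w ws; apply: sS; rewrite in_cons ws orbT.
have [z Sz zc] := sS c (mem_head _ _).
exists (z `&` a); last by rewrite fI big_cons -zc leI2.
by rewrite eI lexI xa andbT; apply: bigmeet_lb => //; exists z.
Qed.

Lemma sigma_ext_mono (u v : K') : u <= v ->
  sigma_ext E' E g u <= sigma_ext E' E g v.
Proof.
by move=> uv; rewrite sigma_ext_adj; apply: (le_trans uv); rewrite -sigma_ext_adj.
Qed.

Lemma meet_bigjoin_le (N : DLplus d) (x z : N) (S : set N) :
  (forall s, S s -> x `&` s <= z) -> x `&` bigjoin S <= z.
Proof.
move=> h; apply: (cjp_le (dlpP N)) => j jp; rewrite lexI => /andP[jx /jp[s Ss js]].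
by apply: le_trans (h s Ss); rewrite lexI jx.
Qed.

Lemma sigma_ext_frobenius :
  (forall a b, g (a `&` f b) = g a `&` b) ->
  forall (u : K') (v : K),
    sigma_ext E' E g (u `&` df v) = sigma_ext E' E g u `&` v.
Proof.
move=> frob u v; apply: le_anti; apply/andP; split.
  rewrite lexI sigma_ext_mono ?leIl //=.
  by rewrite sigma_ext_adj leIr.
rewrite [v in leLHS](join_filter v); apply: meet_bigjoin_le => y [yf yv].
rewrite meetC; apply: meet_bigjoin_le => _ [x [xf xu] <-].
apply: (@le_trans _ _ (filter_ex (x `&` df y))); last first.
  apply: filter_map_le; first exact: filter_meet_closed (delta_filter yf).
  by rewrite leI2 //; exact: complete_mono.
apply: le_bigmeet => // _ [c /= xyc <-].
have [a [b [xa yb abc]]] := filter_compact2 xf (delta_filter yf) xyc.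
have [b' yb' fb'] := delta_filter_compact yf yb.
have [eI _ _ _] := dl_homP e.
apply: (@le_trans _ _ (e (g a `&` b'))).
  by rewrite eI meetC leI2 //; apply: bigmeet_lb => //; exists a.
rewrite ce_unit_le -frob adj_mono //; apply: le_trans abc.
by rewrite leI2.
Qed.
End LeftAdjoint.
Arguments filter_ex {d L L'} E E' g x.

(** * Coherent doctrines *)

Definition doctrine_map (C : category) d (P : functor (opcat C) (DL d))
  (c c' : C) (f : hom c c') : dl_hom (P c') (P c) := fmap P f.

(* ex_adj makes cs_ex f monotone, so that it states an adjunction. *)
Record coherent_structure (C : category) d (P : functor (opcat C) (DL d)) :=
  CoherentStructure {
  cs_lim : has_finite_limits C;
  cs_ex : forall c c' : C, hom c c' -> P c -> P c';
  ex_adj : forall (c c' : C) (f : hom c c') (x : P c) (y : P c'),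
    (cs_ex f x <= y) = (x <= doctrine_map P f y);
  ex_frobenius : forall (c c' : C) (f : hom c c') (x : P c) (y : P c'),
    cs_ex f (x `&` doctrine_map P f y) = cs_ex f x `&` y;
  ex_BC : forall (c1 c2 c p : C) (f1 : hom c1 c) (f2 : hom c2 c)
      (p1 : hom p c1) (p2 : hom p c2), is_pullback f1 f2 p1 p2 ->
    forall x : P c2, doctrine_map P f1 (cs_ex f2 x) = cs_ex p1 (doctrine_map P p2 x) }.

Record coherent_doctrine (C : category) d := CoherentDoctrine {
  cd_fun :> functor (opcat C) (DL d);
  cd_str : coherent_structure cd_fun }.

Record DLplus_doctrine (C : category) d := DLplusDoctrine {
  dd_fun : functor (opcat C) (DLP d);
  dd_str : coherent_structure (fcomp (forget d) dd_fun) }.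

Coercion dd_coherent C d (P : DLplus_doctrine C d) : coherent_doctrine C d :=
  CoherentDoctrine (dd_str P).

Definition ex_ (C : category) d (P : coherent_doctrine C d) (c c' : C)
  (f : hom c c') : P c -> P c' := cs_ex (cd_str P) f.

Arguments ex_ {C d} P {c c'} f x.

(* The pairs (M, alpha), without the conditions on M and on left adjoints. *)
Record doctrine_pair (C D : category) d (P : functor (opcat C) (DL d))
    (Q : functor (opcat D) (DL d)) := DoctrinePair {
  dp_fun : functor C D;
  dp_nat : nat_trans P (fcomp Q (opfun dp_fun)) }.

Definition dp_app (C D : category) d (P : functor (opcat C) (DL d))
    (Q : functor (opcat D) (DL d)) (A : doctrine_pair P Q) (c : C) :
    dl_hom (P c) (Q (dp_fun A c)) := dp_nat A c.

Definition is_coherent_morphism (C D : category) d (P : coherent_doctrine C d)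
    (Q : coherent_doctrine D d) (A : doctrine_pair P Q) : Prop :=
  preserves_finite_limits (dp_fun A) /\
  forall (c c' : C) (f : hom c c') (x : P c),
    dp_app A c' (ex_ P f x) = ex_ Q (fmap (dp_fun A) f) (dp_app A c x).

Definition is_DLplus_morphism (C D : category) d (P : DLplus_doctrine C d)
    (Q : DLplus_doctrine D d) (A : doctrine_pair P Q) : Prop :=
  is_coherent_morphism A /\ forall c : C, complete_morphism (dp_app A c).

(** * The canonical extension of a coherent doctrine *)

Section CanonicalExtensionDoctrine.
Variables (C : category) (d : Order.disp_t) (P : coherent_doctrine C d).
Variable E : forall c : C, canonical_extension (P c).

Definition canext_map (c c' : C) (f : hom c c') :
    dlp_hom (ce_DLplus (E c')) (ce_DLplus (E c)) :=
  delta_map (E c') (E c) (doctrine_map P f).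

Lemma canext_map_id (c : C) : canext_map (idm c) = DLPHom (@dlp_idP _ _).
Proof.
apply: sharp_unique => a; rewrite delta_mapE /=.
by rewrite /doctrine_map (fmap_id P c).
Qed.

Lemma canext_map_cmp (c c' c'' : C) (g : hom c' c'') (f : hom c c') :
  canext_map (cmp g f) = DLPHom (dlp_cmpP (canext_map f) (canext_map g)).
Proof.
apply: sharp_unique => a /=; rewrite !delta_mapE /=.
by rewrite /doctrine_map (@fmap_cmp _ _ P c'' c' c f g).
Qed.

Definition canext_fun : functor (opcat C) (DLP d) :=
  @Functor (opcat C) (DLP d) (fun c => ce_DLplus (E c))
    (fun a b f => @canext_map b a f) canext_map_id
    (fun a b c g f => @canext_map_cmp c b a f g).

Lemma canext_adj (c c' : C) (f : hom c c')
    (u : ce_DLplus (E c)) (v : ce_DLplus (E c')) :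
  (sigma_ext (E c) (E c') (ex_ P f) u <= v) = (u <= canext_map f v).
Proof. exact/sigma_ext_adj/(ex_adj (cd_str P)). Qed.

Lemma canext_frobenius (c c' : C) (f : hom c c')
    (u : ce_DLplus (E c)) (v : ce_DLplus (E c')) :
  sigma_ext (E c) (E c') (ex_ P f) (u `&` canext_map f v)
  = sigma_ext (E c) (E c') (ex_ P f) u `&` v.
Proof.
apply: sigma_ext_frobenius; first exact: (ex_adj (cd_str P)).
exact: (ex_frobenius (cd_str P)).
Qed.

Lemma canext_BC (c1 c2 c p : C) (f1 : hom c1 c) (f2 : hom c2 c)
    (p1 : hom p c1) (p2 : hom p c2) : is_pullback f1 f2 p1 p2 ->
  forall u : ce_DLplus (E c2),
    canext_map f1 (sigma_ext (E c2) (E c) (ex_ P f2) u)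
    = sigma_ext (E p) (E c1) (ex_ P p1) (canext_map p2 u).
Proof.
move=> pb u; apply: le_anti; apply/andP; split; last first.
  rewrite canext_adj.
  have -> (v : ce_DLplus (E c)) :
      canext_map p1 (canext_map f1 v) = canext_map p2 (canext_map f2 v).
    have h1 := canext_map_cmp f1 p1; have h2 := canext_map_cmp f2 p2.
    rewrite pb.1 in h1; rewrite h1 in h2.
    exact: (congr1 (fun h => dlp_fun h v) h2).
  by apply: complete_mono; rewrite -canext_adj.
rewrite {1}/sigma_ext (dlp_homP (canext_map f1) _).1.
apply: bigjoin_le; first exact: (dlpP _).1.
move=> _ [_ [x [xf xu] <-] <-].
have padj : forall a b, (ex_ P p1 a <= b) = (a <= doctrine_map P p1 b).
  exact: (ex_adj (cd_str P)).
have p2f : filter_element (ce_unit (E p)) (canext_map p2 x).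
  exact: delta_filter.
apply: (@le_trans _ _ (filter_ex (E c1) (E p) (ex_ P p1) (canext_map p2 x))).
  apply: le_bigmeet; first exact: (dlpP _).1.
  move=> _ [b /= xb <-].
  have [a xa ab] := delta_filter_compact xf xb.
  apply: (@le_trans _ _ (canext_map f1 (ce_unit (E c) (ex_ P f2 a)))).
    apply: complete_mono; apply: bigmeet_lb; first exact: (dlpP _).1.
    by exists a.
  rewrite delta_mapE ce_unit_le /ex_ (ex_BC (cd_str P) pb) -/(ex_ P p1 _).
  exact: (adj_mono padj).
by apply: filter_map_le => //; exact: complete_mono.
Qed.

Definition canext_structure : coherent_structure (fcomp (forget d) canext_fun) :=
  @CoherentStructure C d (fcomp (forget d) canext_fun) (cs_lim (cd_str P))
    (fun c c' f => sigma_ext (E c) (E c') (ex_ P f))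
    canext_adj canext_frobenius canext_BC.

Definition canext_doctrine : DLplus_doctrine C d :=
  DLplusDoctrine canext_structure.

Definition canext_unit_app (c : C) : @hom (DL d) (P c) (canext_doctrine c) :=
  ce_unit (E c).

Lemma canext_unitP (a b : opcat C) (f : @hom (opcat C) a b) :
  cmp (canext_unit_app b) (fmap P f) =
  cmp (fmap canext_doctrine f) (canext_unit_app a).
Proof. by apply: dl_hom_eq => x /=; rewrite delta_mapE. Qed.

Definition canext_unit : nat_trans P canext_doctrine :=
  @NatTrans _ _ P canext_doctrine canext_unit_app canext_unitP.

Section Sharp.
Variables (D : category) (Q : DLplus_doctrine D d) (M : functor C D).
Variable alpha : nat_trans P (fcomp Q (opfun M)).

Definition alpha_app (c : C) : dl_hom (P c) (dd_fun Q (M c)) := alpha c.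

Definition nat_sharp_app (c : C) :
    @hom (DL d) (canext_doctrine c) (fcomp Q (opfun M) c) :=
  forget_hom (sharp (E c) (alpha_app c)).

Lemma nat_sharpP (a b : opcat C) (f : @hom (opcat C) a b) :
  cmp (nat_sharp_app b) (fmap canext_doctrine f) =
  cmp (fmap (fcomp Q (opfun M)) f) (nat_sharp_app a).
Proof.
apply: dl_hom_eq => x /=.
set g := sharp (E b) _; set h := sharp (E a) _.
pose k := fmap (dd_fun Q) (fmap (opfun M) f) : dlp_hom _ _.
suff /(congr1 (fun h => dlp_fun h x)) :
  DLPHom (dlp_cmpP g (canext_map f)) = DLPHom (dlp_cmpP k h) by [].
apply: sharp_unique => y /=; rewrite delta_mapE !sharpE.
exact: (congr1 (fun h => dl_fun h y) (ntcP alpha f)).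
Qed.

Definition nat_sharp : nat_trans canext_doctrine (fcomp Q (opfun M)) :=
  @NatTrans _ _ canext_doctrine (fcomp Q (opfun M)) nat_sharp_app nat_sharpP.
End Sharp.
End CanonicalExtensionDoctrine.

(* Composition with the unit is the restriction to P c, seen inside its
   canonical extension. *)
Definition doctrine_restrict (C : category) d (P : coherent_doctrine C d)
    (E : forall c : C, canonical_extension (P c))
    (D : category) (Q : coherent_doctrine D d)
    (A : doctrine_pair (canext_doctrine E) Q) : doctrine_pair P Q :=
  DoctrinePair (nat_cmp (dp_nat A) (canext_unit E)).

(* Main.v *)
Require Import Defs.
From mathcomp Require Import all_boot all_order.

Set Implicit Arguments.
Unset Strict Implicit.
Unset Printing Implicit Defensive.

Import Order.TTheory.
Local Open Scope order_scope.

(** A complete morphism on a canonical extension is determined by its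
    restriction to the lattice, so the only candidate in (i) is [alpha^sharp].
    Naturality alone gives [ex_(M f) o alpha^sharp <= alpha^sharp o ex_f], so
    only the converse inequality matters.  It is stable under composition, and
    [f] is its graph [<1, f>] followed by a product projection, to which (iii)
    applies.  The graph [s] is split by the other projection [r], so Frobenius
    gives [ex_s x = ex_s 1 /\ r^* x]: the inequality for [s] reduces to the
    element [ex_s 1], which comes from [P], where [alpha] commutes with the
    left adjoints. *)

(** * Calculus of left adjoints in a coherent doctrine *)

Section LeftAdjoints.
Variables (C : category) (d : Order.disp_t) (P : coherent_doctrine C d).

Lemma ex_adjoint (c c' : C) (f : hom c c') (x : P c) (y : P c') :
  (ex_ P f x <= y) = (x <= doctrine_map P f y).
Proof. exact: ex_adj. Qed.

Lemma doctrine_map_cmp (c c' c'' : C) (g : hom c' c'') (f : hom c c')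
    (y : P c'') :
  doctrine_map P (cmp g f) y = doctrine_map P f (doctrine_map P g y).
Proof. by rewrite /doctrine_map (@fmap_cmp _ _ P c'' c' c f g). Qed.

Lemma doctrine_map_id (c : C) (x : P c) : doctrine_map P (idm c) x = x.
Proof. by rewrite /doctrine_map (fmap_id P c). Qed.

Lemma ex_mono (c c' : C) (f : hom c c') (x y : P c) :
  x <= y -> ex_ P f x <= ex_ P f y.
Proof.
by move=> xy; rewrite ex_adjoint; apply: (le_trans xy); rewrite -ex_adjoint.
Qed.

(** Both sides are left adjoint to [doctrine_map P (cmp g f)]. *)
Lemma ex_cmp (c c' c'' : C) (g : hom c' c'') (f : hom c c') (x : P c) :
  ex_ P (cmp g f) x = ex_ P g (ex_ P f x).
Proof.
apply: le_anti; apply/andP; split.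
  by rewrite ex_adjoint doctrine_map_cmp -!ex_adjoint.
by rewrite !ex_adjoint -doctrine_map_cmp -ex_adjoint.
Qed.

Lemma ex_section (c c' : C) (s : hom c c') (r : hom c' c) (x : P c) :
  cmp r s = idm c -> ex_ P s x = ex_ P s \top `&` doctrine_map P r x.
Proof.
move=> rs; rewrite /ex_ -(ex_frobenius (cd_str P)) meet1x -/(ex_ P s _).
by rewrite -doctrine_map_cmp rs doctrine_map_id.
Qed.

End LeftAdjoints.

(** * The inequality of (iii) at a single arrow *)

Section LaxPairs.
Variables (C D : category) (d : Order.disp_t).
Variables (P : coherent_doctrine C d) (Q : coherent_doctrine D d).
Variable A : doctrine_pair P Q.
Notation M := (dp_fun A).

Definition lax_at (c c' : C) (f : hom c c') : Prop :=
  forall x : P c, dp_app A c' (ex_ P f x) <= ex_ Q (fmap M f) (dp_app A c x).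

Lemma dp_app_mono (c : C) (x y : P c) : x <= y -> dp_app A c x <= dp_app A c y.
Proof.
have [AI _ _ _] := dl_homP (dp_app A c).
by move=> xy; rewrite -(meet_idPl xy) AI leIr.
Qed.

Lemma dp_app_map (c c' : C) (f : hom c c') (y : P c') :
  dp_app A c (doctrine_map P f y) = doctrine_map Q (fmap M f) (dp_app A c' y).
Proof. exact: (congr1 (fun h => dl_fun h y) (ntcP (dp_nat A) f)). Qed.

(** Transposed and rewritten by naturality, this is the image under [A] of the unit
    [x <= f^* (ex_f x)]. *)
Lemma ex_dp_app (c c' : C) (f : hom c c') (x : P c) :
  ex_ Q (fmap M f) (dp_app A c x) <= dp_app A c' (ex_ P f x).
Proof.
by rewrite ex_adjoint -dp_app_map; apply: dp_app_mono; rewrite -ex_adjoint.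
Qed.

Lemma lax_cmp (c c' c'' : C) (g : hom c' c'') (f : hom c c') :
  lax_at g -> lax_at f -> lax_at (cmp g f).
Proof.
move=> gl fl x; rewrite fmap_cmp !ex_cmp.
by apply: (le_trans (gl _)); apply: ex_mono; exact: fl.
Qed.

(** [M] preserves the splitting, so [ex_section] applies in [P] and in [Q]; the factors [r^* x]
    match by naturality. *)
Lemma lax_section (c c' : C) (s : hom c c') (r : hom c' c) :
  cmp r s = idm c ->
  dp_app A c' (ex_ P s \top) <= ex_ Q (fmap M s) \top -> lax_at s.
Proof.
move=> rs s1 x; have [AI _ _ _] := dl_homP (dp_app A c').
rewrite (ex_section _ rs) AI dp_app_map (@ex_section _ _ _ _ _ _ (fmap M r)).
  by rewrite leI2.
by rewrite -fmap_cmp rs fmap_id.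
Qed.

End LaxPairs.

(** * Binary products as limits of discrete diagrams *)

Section Discrete.
Variable T : eqType.

(** Arrows are equality proofs; these are unique over an [eqType], which gives the category laws. *)
Definition discrete : category :=
  @Category T (fun a b => a = b) (fun a => erefl a)
    (fun a b c (q : b = c) (p : a = b) => etrans p q)
    (fun _ _ _ _ _ _ _ => eq_irrelevance _ _)
    (fun _ _ _ => eq_irrelevance _ _) (fun _ _ _ => eq_irrelevance _ _).

Variables (C : category) (F : T -> C).

Definition discrete_map (a b : discrete) (p : hom a b) : hom (F a) (F b) :=
  let: erefl := p in idm (F a).

Lemma discrete_map_cmp (a b c : discrete) (q : hom b c) (p : hom a b) :
  discrete_map (cmp q p) = cmp (discrete_map q) (discrete_map p).
Proof. by case: c / q; case: b / p; rewrite /= cmp1m. Qed.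

Definition discrete_functor : functor discrete C :=
  @Functor discrete C F discrete_map (fun _ => erefl) discrete_map_cmp.

Variables (x : C) (l : forall a, hom x (F a)).

Lemma discrete_legP (a b : discrete) (p : hom a b) :
  cmp (fmap discrete_functor p) (l a) = l b.
Proof. by case: b / p; exact: cmp1m. Qed.

Definition discrete_cone : cone discrete_functor :=
  @Cone _ _ discrete_functor x l discrete_legP.

End Discrete.

Lemma discrete_finite (T : finType) : finite_category (discrete T).
Proof.
split; first by exists #|T|, enum_val => x; exists (enum_rank x); rewrite enum_rankK.
move=> a b; have [ab|nab] := eqVneq a b.
  by exists 1, (fun=> ab) => p; exists ord0; exact: eq_irrelevance.
have no (p : a = b) : False by rewrite p eqxx in nab.
have f0 (i : 'I_0) : a = b by case: i.
by exists 0, f0 => p; case: (no p).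
Qed.

Lemma binary_product (C : category) : has_finite_limits C -> forall a b : C,
  exists (p : C) (p1 : hom p a) (p2 : hom p b), is_product p1 p2.
Proof.
move=> Clim a b; pose F (i : bool) := if i then a else b.
have [K Klim] := Clim _ (discrete_finite bool) (discrete_functor F).
exists (apex K), (leg K true), (leg K false) => x g1 g2.
pose l (i : bool) : hom x (F i) := if i return hom x (F i) then g1 else g2.
have [h [hl huniq]] := Klim (discrete_cone l).
exists h; split=> [|k [k1 k2]]; first by split; [exact: (hl true)|exact: (hl false)].
by apply: huniq => -[].
Qed.

Lemma is_product_swap (C : category) (c1 c2 p : C) (p1 : hom p c1)
  (p2 : hom p c2) : is_product p1 p2 -> is_product p2 p1.
Proof.
move=> pP x g1 g2; have [h [[h1 h2] huniq]] := pP x g2 g1.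
by exists h; split=> // k [k1 k2]; apply: huniq.
Qed.

Lemma lax_of_projections (C D : category) d (P : coherent_doctrine C d)
    (Q : coherent_doctrine D d) (A : doctrine_pair P Q) :
  (forall (c c' : C) (f : hom c c'),
    dp_app A c' (ex_ P f \top) <= ex_ Q (fmap (dp_fun A) f) \top) ->
  (forall (c1 c2 p : C) (p1 : hom p c1) (p2 : hom p c2),
    is_product p1 p2 -> lax_at A p1) ->
  forall (c c' : C) (f : hom c c'), lax_at A f.
Proof.
move=> A1 Aproj c c' f.
have [p [p1 [p2 pP]]] := binary_product (cs_lim (cd_str P)) c c'.
have [s [[p1s p2s] _]] := pP _ (idm c) f.
(* Here [s] is the graph of [f], split by [p1]; swapping the factors makes [p2] a left
   projection. *)
rewrite -p2s; apply: lax_cmp; first exact: Aproj (is_product_swap pP).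
exact: lax_section p1s (A1 _ _ _).
Qed.

(** By adjunction this reduces to the unit [a <= f (g a)] in [L']. *)
Lemma sigma_ext_unit_le d (L L' : tbDistrLatticeType d)
    (E : canonical_extension L) (E' : canonical_extension L')
    (f : dl_hom L L') (g : L' -> L) :
  (forall a b, (g a <= b) = (a <= f b)) ->
  forall a, sigma_ext E' E g (ce_unit E' a) <= ce_unit E (g a).
Proof.
by move=> gf a; rewrite (sigma_ext_adj gf) delta_mapE ce_unit_le -gf.
Qed.

(** * Morphisms out of the canonical extension *)

Section CanonicalExtensionPairs.
Variables (C D : category) (d : Order.disp_t) (P : coherent_doctrine C d).
Variable E : forall c : C, canonical_extension (P c).
Variable Q : DLplus_doctrine D d.

Lemma DLplus_morphism_sharp (A : doctrine_pair (canext_doctrine E) Q) :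
  (forall c, complete_morphism (dp_app A c)) ->
  A = DoctrinePair (nat_sharp E (dp_nat (doctrine_restrict A))).
Proof.
case: A => N b /= bC; congr DoctrinePair; apply: nat_trans_eq => c.
apply: dl_hom_eq => u /=.
set s := sharp _ _.
(* Completeness turns the component into a [dlp_hom], so that [sharp_unique] applies. *)
suff /(congr1 (fun h => dlp_fun h u)) :
  @DLPHom _ (ce_DLplus (E c)) (dd_fun Q (N c)) _ (bC c) = s by [].
by apply: sharp_unique => a; rewrite sharpE.
Qed.

Variables (M : functor C D) (alpha : nat_trans P (fcomp Q (opfun M))).

Lemma nat_sharp_complete (c : C) :
  complete_morphism (dp_app (DoctrinePair (nat_sharp E alpha)) c).
Proof. exact: (dlp_homP (sharp (E c) (alpha_app alpha c))). Qed.

Lemma nat_sharp_unit (c : C) (a : P c) :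
  dp_app (DoctrinePair (nat_sharp E alpha)) c (ce_unit (E c) a)
  = dp_app (DoctrinePair alpha) c a.
Proof. exact: sharpE. Qed.

Lemma nat_sharp_restrict :
  doctrine_restrict (DoctrinePair (nat_sharp E alpha) :
    doctrine_pair (canext_doctrine E) Q) = DoctrinePair alpha.
Proof.
congr DoctrinePair; apply: nat_trans_eq => c; apply: dl_hom_eq => a.
exact: nat_sharp_unit.
Qed.

(** The top element comes from [P], so its image under the extended adjoint lies below that of
    [ex_ P f \top], where [alpha] commutes with left adjoints. *)
Lemma nat_sharp_ex_top : is_coherent_morphism (DoctrinePair alpha) ->
  forall (c c' : C) (f : hom c c'),
  dp_app (DoctrinePair (nat_sharp E alpha)) c'
    (ex_ (canext_doctrine E) f \top) <= ex_ Q (fmap M f) \top.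
Proof.
move=> [_ alpha_ex] c c' f.
have [_ _ _ e1] := dl_homP (ce_unit (E c)).
have [_ _ _ a1] := dl_homP (dp_app (DoctrinePair alpha) c).
apply: (@le_trans _ _ (dp_app (DoctrinePair (nat_sharp E alpha)) c'
  (ce_unit (E c') (ex_ P f \top)))).
  apply: (@dp_app_mono _ _ _ (canext_doctrine E) Q).
  rewrite -e1; exact: (sigma_ext_unit_le _ _ (ex_adjoint f)).
by rewrite nat_sharp_unit alpha_ex a1.
Qed.

End CanonicalExtensionPairs.

Theorem theorem3p1 (C D : category) (d : Order.disp_t)
    (P : coherent_doctrine C d)
    (E : forall c : C, canonical_extension (P c))
    (Q : DLplus_doctrine D d)
    (M : functor C D) (alpha : nat_trans P (fcomp Q (opfun M)))
    (malpha : is_coherent_morphism (DoctrinePair alpha)) :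
  let Pdelta : DLplus_doctrine C d := canext_doctrine E in
  let Msharp : doctrine_pair Pdelta Q := DoctrinePair (nat_sharp E alpha) in
  let i : Prop := exists A : doctrine_pair Pdelta Q,
    is_DLplus_morphism A /\ doctrine_restrict A = DoctrinePair alpha in
  let ii : Prop := is_DLplus_morphism Msharp in
  let iii : Prop := forall (c1 c2 c12 : C) (pi1 : hom c12 c1) (pi2 : hom c12 c2),
    is_product pi1 pi2 ->
    forall u : Pdelta c12,
      dp_app Msharp c1 (sigma_ext (E c12) (E c1) (ex_ P pi1) u)
      <= ex_ Q (fmap M pi1) (dp_app Msharp c12 u) in
  (i <-> ii) /\ (ii <-> iii).
Proof.
move=> Pdelta Msharp i ii iii; split; split.
- move=> [A [AP AE]].
  by have := AP; rewrite {1}(DLplus_morphism_sharp AP.2) AE.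
- by move=> MP; exists Msharp; split; [|exact: nat_sharp_restrict].
- move=> [[_ Mex] _] c1 c2 c12 pi1 pi2 _ u.
  (* The left adjoint of [Pdelta] is [sigma_ext] by definition, so (iii) weakens an equality in
     (ii). *)
  by rewrite -[leRHS](Mex _ _ pi1 u).
- move=> proj; split; last exact: nat_sharp_complete.
  split; first exact: malpha.1.
  move=> c c' f x; apply: le_anti; rewrite ex_dp_app andbT.
  by apply: lax_of_projections; [exact: nat_sharp_ex_top|exact: proj].
Qed.
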